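(* Define polynomials $P_k,Q_k$ by $P_0(t)=Q_0(t)=1$, $P_{k+1}(t)=tP_k(t)+P_k'(t)$ for $k\ge0$, and $Q_k(t)=P_k(t)+Q_{k-1}'(t)$ for $k\ge1$. Write $P_k(t)=\sum_{m\ge0}p_{k,m}t^m$ and $Q_k(t)=\sum_{m\ge0}q_{k,m}t^m$ for $k\ge 0$, and set $n=\frac{k-m}{2}$. If $m>k$ or $k-m$ is odd, then $p_{k,m}=q_{k,m}=0$. If $k\equiv m\pmod 2$ and $k\ge m$, then $$p_{k,m}=\frac{k!}{m!\,2^n\,n!}\qquad\text{and}\qquad q_{k,m}=\frac{\left(\frac{k+m}{2}\right)!}{m!}\,2^{-n}\sum_{j=0}^n\binom{k+1}{j}.$$ *)

(* Defs.v *)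
From mathcomp Require Import all_boot all_order all_algebra.
Set Implicit Arguments.
Unset Strict Implicit.
Unset Printing Implicit Defensive.
Import GRing.Theory Num.Theory.
Local Open Scope ring_scope.

Fixpoint P_poly (R : numFieldType) (k : nat) : {poly R} :=
  if k is k'.+1 then 'X * P_poly R k' + (P_poly R k')^`() else 1.

Fixpoint Q_poly (R : numFieldType) (k : nat) : {poly R} :=
  if k is k'.+1 then P_poly R k'.+1 + (Q_poly R k')^`() else 1.

(* Main.v *)
Require Import Defs.
From mathcomp Require Import all_boot all_order all_algebra.
From mathcomp Require Import zify ring.
Import GRing.Theory Num.Theory.
Local Open Scope ring_scope.

(** Both families are determined by the coefficient recurrences
    [p_(k+1,m) = p_(k,m-1) + (m+1) p_(k,m+1)] and
    [q_(k,m) = p_(k,m) + (m+1) q_(k-1,m+1)]. With [k = m + 2n], the closed form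
    of [p] satisfies the first because [m + 2n = k]. Pascal's rule turns
    [\sum_(j <= n) 'C(k+1, j)] into [2 \sum_(j < n) 'C(k, j) + 'C(k, n)], whose
    two summands are exactly the two terms of the second recurrence. *)

Section Coefficients.

Variable R : numFieldType.
Implicit Types k m n : nat.

Lemma coef_P_polyS k m :
  (P_poly R k.+1)`_m
  = (if m is m'.+1 then (P_poly R k)`_m' else 0) + (P_poly R k)`_m.+1 *+ m.+1.
Proof. by rewrite /= coefD coefXM coef_deriv; case: m. Qed.

Lemma coef_Q_polyS k m :
  (Q_poly R k.+1)`_m = (P_poly R k.+1)`_m + (Q_poly R k)`_m.+1 *+ m.+1.
Proof. by rewrite [in LHS]/= coefD coef_deriv. Qed.

(** The disjunction passes from [(k.+1, m)] to [(k, m.+1)] and, for positive [m], to [(k, m.-1)], so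
    both terms of the recurrence vanish. *)
Lemma coef_P_poly_eq0 k m : (k < m)%N || odd (k + m) -> (P_poly R k)`_m = 0.
Proof.
elim: k m => [|k IHk] m hm; first by rewrite coef1; case: m hm.
rewrite coef_P_polyS IHk; last by lia.
by case: m hm => [|m] hm; rewrite ?IHk ?mul0rn ?addr0 //; lia.
Qed.

Lemma coef_Q_poly_eq0 k m : (k < m)%N || odd (k + m) -> (Q_poly R k)`_m = 0.
Proof.
elim: k m => [|k IHk] m hm; first by rewrite coef1; case: m hm.
by rewrite coef_Q_polyS IHk ?coef_P_poly_eq0 ?mul0rn ?addr0 //; lia.
Qed.

Lemma natr_fact_neq0 n : n`!%:R != 0 :> R.
Proof. by rewrite pnatr_eq0 -lt0n fact_gt0. Qed.

Lemma coef_P_poly m n :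
  (P_poly R (m + n.*2))`_m = (m + n.*2)`!%:R / (m`!%:R * 2 ^+ n * n`!%:R).
Proof.
move Dk: (m + n.*2)%N => k.
(* Induction is on [k], since the recurrence leads to both [(m-1, n)] and [(m+1, n-1)]. *)
elim: k m n Dk => [|k IHk] m n Dk.
  have [-> ->] : m = 0%N /\ n = 0%N by lia.
  by rewrite coef1 fact0 expr0 !mulr1 divr1.
have hm := natr_fact_neq0 m; have hn := natr_fact_neq0 n.
have two_neq0 : 2 != 0 :> R by rewrite pnatr_eq0.
have e2 : 2 ^+ n != 0 :> R by rewrite expf_neq0.
(* The summand with factor [m] will be the shifted coefficient, the one with [2n] the derivative
   term; each vanishes at [m = 0], resp. [n = 0]. *)
have -> : k.+1`!%:R / (m`!%:R * 2 ^+ n * n`!%:R)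
  = (m%:R + 2 * n%:R) * (k`!%:R / (m`!%:R * 2 ^+ n * n`!%:R)) :> R.
  by rewrite factS -Dk natrM natrD -muln2 natrM mulrA (mulrC 2).
rewrite coef_P_polyS mulrDl; congr (_ + _).
  case: m Dk hm => [|m] Dk; first by rewrite mul0r.
  rewrite (IHk m n) ?factS ?natrM; last by lia.
  rewrite mulf_eq0 negb_or => /andP[m_neq0 mf_neq0].
  move: (m.+1%:R : R) m_neq0 => a a_neq0.
  by field; rewrite a_neq0 mf_neq0 e2 hn.
case: n Dk hn e2 => [|n] Dk hn e2.
  by rewrite coef_P_poly_eq0 ?mul0rn ?mulr0 ?mul0r //; lia.
rewrite -[_ *+ m.+1]mulr_natr (IHk m.+1 n); last by lia.
move: hn e2; rewrite !factS !natrM exprS !mulf_eq0 !negb_or.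
move=> /andP[n_neq0 nf_neq0] /andP[_ e_neq0].
have m_neq0 : m.+1%:R != 0 :> R by rewrite pnatr_eq0.
move: (m.+1%:R : R) (n.+1%:R : R) m_neq0 n_neq0 => a b a_neq0 b_neq0.
by field; rewrite b_neq0 nf_neq0 e_neq0 hm a_neq0.
Qed.

Lemma sum_binS k n :
  (\sum_(0 <= j < n.+1) 'C(k.+1, j)
   = 2 * (\sum_(0 <= j < n) 'C(k, j)) + 'C(k, n))%N.
Proof.
elim: n => [|n IHn]; first by rewrite big_nat1 big_geq // !bin0.
rewrite big_nat_recr //= IHn binS [in RHS]big_nat_recr //=; lia.
Qed.

(** Gives [p] the prefactor of [q], so that the last term of [sum_binS] becomes [p]. *)
Lemma coef_P_poly_bin m n :
  (P_poly R (m + n.*2))`_m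
  = (m + n)`!%:R / m`!%:R * 2 ^- n * 'C(m + n.*2, n)%:R.
Proof.
rewrite coef_P_poly.
have <- : ('C(m + n.*2, n) * (n`! * (m + n)`!) = (m + n.*2)`!)%N.
  have le_n : (n <= m + n.*2)%N by lia.
  by rewrite -(bin_fact le_n); do !congr (_ * _)%N; congr (_`!); lia.
have e2 : 2 ^+ n != 0 :> R by rewrite expf_neq0 // pnatr_eq0.
have hm := natr_fact_neq0 m; have hn := natr_fact_neq0 n.
by rewrite !natrM; field; rewrite hm hn e2.
Qed.

Lemma coef_Q_poly m n :
  (Q_poly R (m + n.*2))`_m
  = (m + n)`!%:R / m`!%:R * 2 ^- n
    * \sum_(0 <= j < n.+1) 'C((m + n.*2).+1, j)%:R.
Proof.
elim: n m => [|n IHn] m.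
  (* At [n = 0] the derivative term lies above the degree, so [q] equals [p]. *)
  rewrite big_nat1 bin0 mulr1; have := coef_P_poly_bin m 0.
  rewrite bin0 mulr1 => <-; rewrite addn0.
  case: m => // m; rewrite coef_Q_polyS coef_Q_poly_eq0 ?mul0rn ?addr0 //; lia.
rewrite -natr_sum sum_binS natrD mulrDr -coef_P_poly_bin [RHS]addrC.
have -> : (m + n.+1.*2 = (m.+1 + n.*2).+1)%N by lia.
rewrite coef_Q_polyS IHn -natr_sum; congr (_ + _).
rewrite -[_ *+ m.+1]mulr_natr -addSnnS [m.+1`!]factS !natrM exprS.
have e2 : 2 ^+ n != 0 :> R by rewrite expf_neq0 // pnatr_eq0.
have m_neq0 : m.+1%:R != 0 :> R by rewrite pnatr_eq0.
have hm := natr_fact_neq0 m.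
move: (m.+1%:R : R) m_neq0 => a a_neq0.
by field; rewrite e2 hm a_neq0.
Qed.

End Coefficients.

Theorem theorem1 (R : numFieldType) (k m : nat) :
  let n := ((k - m) %/ 2)%N in
  ((m > k)%N \/ k <> m %[mod 2] ->
     (P_poly R k)`_m = 0 /\ (Q_poly R k)`_m = 0) /\
  (k = m %[mod 2] -> (m <= k)%N ->
     (P_poly R k)`_m = (k`!)%:R / ((m`!)%:R * 2 ^+ n * (n`!)%:R) /\
     (Q_poly R k)`_m =
       (((k + m) %/ 2)`!)%:R / (m`!)%:R * 2 ^- n
       * \sum_(0 <= j < n.+1) ('C(k.+1, j))%:R).
Proof.
move=> n; split=> [hkm|km_mod le_mk].
  have h : (k < m)%N || odd (k + m) by lia.
  by rewrite coef_P_poly_eq0 ?coef_Q_poly_eq0.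
(* Equal parity and [m <= k] make the truncated subtraction and the halving exact. *)
have Dk : (k = m + n.*2)%N by rewrite /n; lia.
have -> : ((k + m) %/ 2 = m + n)%N by lia.
by move: n Dk => n ->; rewrite coef_P_poly coef_Q_poly.
Qed.
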